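(* Let $\precsim$ be a quasi-finite partial order on $X$ whose strict part coincides with the causal precedence of a distributed system $(\bigcup_{i=1}^n(X_i,\precsim_i),\mathcal{P}=\bigcup_{i\neq j}\mathcal{P}_{ij})$ with $X=\bigcup_i X_i$. Let $\{w_i\}_{i=1}^n$ be utilities $w_i:(X_i,\precsim_i)\to(0,1)$ (i.e. $x\precsim_i y\iff w_i(x)\le w_i(y)$), and let $\mathcal{U}=\{u_l\}_{l=1}^k$ be a bijective Richter-Peleg multi-utility representation of the finite quotient poset $Q$ associated to the distributed system. For $l=1,\dots,k$ define $v_l:X\to\mathbb{R}$ by $v_l(x)=u_l(\bar{x})+w_i(x)$ if $x\in X_i$, where $\bar x$ is the class of $x$ in $X_i/\mathcal{I}_i$. Then $\mathcal{V}=\{v_l\}_{l=1}^k$ is a Richter-Peleg multi-utility representation of $\precsim$.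
   Context: A communication from $A$ to $B$ is a finite relation $\mathcal{P}\subseteq A\times B$ such that each element of $A$ is related to at most one element of $B$ and vice versa. A distributed system consists of pairwise disjoint totally ordered sets (processes) $(X_i,\precsim_i)$, $i=1,\dots,n$, and communications $\mathcal{P}_{ij}$ from $X_i$ to $X_j$ ($i\ne j$, possibly empty); its causal precedence $\rightarrow$ is the transitive closure of the union of the strict orders $\prec_i$ and all $\mathcal{P}_{ij}$ (assumed acyclic, i.e. a strict partial order). A partial order is quasi-finite if (its strict part) is the causal precedence of a distributed system. Let $\overline{\mathcal{P}}_{ij}$ be given by $x\overline{\mathcal{P}}_{ij}y$ iff $x\precsim_i x'\mathcal{P}_{ij}y'\precsim_j y$ for some $x',y'$. Trace equivalences on $X_i$: $a\sim^*_{ij}b$ iff for all $z\in X_j$ ($a\overline{\mathcal{P}}_{ij}z\iff b\overline{\mathcal{P}}_{ij}z$); $a\sim^{**}_{ji}b$ iff for all $c\in X_j$ ($c\overline{\mathcal{P}}_{ji}a\iff c\overline{\mathcal{P}}_{ji}b$). $\mathcal{I}_i$ is the intersection of all $\sim^*_{ij}$ and $\sim^{**}_{ji}$, $j\ne i$; each $X_i/\mathcal{I}_i$ is finite and inherits a total order $\overline{\precsim}_i$ from $\precsim_i$. The quotient poset $Q$ is the finite set $\bigsqcup_i X_i/\mathcal{I}_i$ ordered by the reflexive-transitive closure $\sqsubseteq$ of the orders $\overline{\precsim}_i$ together with the relations $\bar x\sqsubseteq\bar y$ whenever $x\mathcal{P}_{ij}y$. A Richter-Peleg multi-utility representation of a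 partial order $\precsim$ on $S$ is a family $\mathcal{F}$ of real functions on $S$ with $x\precsim y\iff f(x)\le f(y)$ for all $f\in\mathcal{F}$, and $x\prec y\Rightarrow f(x)<f(y)$ for all $f\in\mathcal{F}$. It is bijective (for a finite poset with $N$ elements) if each $f$ is a bijection onto $\{1,\dots,N\}$. *)

(* Defs.v *)
(* MathComp-Analysis, over an abstract R : realType *)
From Stdlib Require Import Relation_Definitions Relation_Operators.
From mathcomp Require Import all_boot all_order all_algebra generic_quotient.
From mathcomp Require Import boolp classical_sets functions cardinality reals.

Set Implicit Arguments.
Unset Strict Implicit.
Unset Printing Implicit Defensive.

Import Order.TTheory GRing.Theory Num.Theory.

Local Open Scope order_scope.
Local Open Scope quotient_scope.
Local Open Scope classical_set_scope.
Local Open Scope card_scope.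

Definition is_communication (A B : Type) (P : set (A * B)) : Prop :=
  [/\ finite_set P,
      forall a b b', P (a, b) -> P (a, b') -> b = b' &
      forall a a' b, P (a, b) -> P (a', b) -> a = a'].

Section Carrier.
Variables (d : Order.disp_t) (n : nat) (proc : 'I_n -> orderType d).
Variable comm : forall i j : 'I_n, set (proc i * proc j).

Inductive causal_step : {i : 'I_n & proc i} -> {i : 'I_n & proc i} -> Prop :=
| causal_local i (x y : proc i) : x < y ->
    causal_step (Tagged proc x) (Tagged proc y)
| causal_comm i j (x : proc i) (y : proc j) : comm (x, y) ->
    causal_step (Tagged proc x) (Tagged proc y).

End Carrier.

(* Only the communications with i != j are data; comm i i is set to be empty.
   The common display d is a mere notation tag: the orders are unrelated. *)
Record distributed_system (d : Order.disp_t) (n : nat) := DistributedSystem {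
  proc : 'I_n -> orderType d;
  comm : forall i j : 'I_n, set (proc i * proc j);
  comm_diag : forall i : 'I_n, @comm i i = set0;
  commP : forall i j : 'I_n, is_communication (@comm i j);
  causal_acyclic : forall x, ~ clos_trans _ (causal_step comm) x x
}.

Arguments proc {d n} S i : rename.
Arguments comm {d n} S i j : rename.

Section DistributedSystem.
Variables (d : Order.disp_t) (n : nat) (S : distributed_system d n).

(* The disjoint union of the processes. MathComp equips sigma types with a
   lexicographic order, which plays no role here. *)
Definition events : Type := {i : 'I_n & proc S i}.

Definition causal : relation events := clos_trans _ (causal_step (comm S)).

Definition comm_closure (i j : 'I_n) (x : proc S i) (y : proc S j) : Prop :=
  exists x' y', [/\ x <= x', comm S i j (x', y') & y' <= y].

Definition trace_out (i j : 'I_n) (a b : proc S i) : Prop :=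
  forall z : proc S j, comm_closure a z <-> comm_closure b z.

Definition trace_in (j i : 'I_n) (a b : proc S i) : Prop :=
  forall c : proc S j, comm_closure c a <-> comm_closure c b.

Definition trace_rel (i : 'I_n) : rel (proc S i) := fun a b =>
  `[< forall j : 'I_n, j != i -> trace_out j a b /\ trace_in j a b >].

Lemma trace_rel_refl i : reflexive (@trace_rel i).
Proof. by move=> a; apply/asboolP => j _; split=> z. Qed.

Lemma trace_rel_sym i : symmetric (@trace_rel i).
Proof.
suff H a b : @trace_rel i a b -> trace_rel b a by move=> a b; apply/idP/idP; exact: H.
move=> /asboolP ab; apply/asboolP => j /ab[o t].
by split=> z; split=> /[dup] _ h; [apply/o|apply/o|apply/t|apply/t].
Qed.

Lemma trace_rel_trans i : transitive (@trace_rel i).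
Proof.
move=> b a c /asboolP ab /asboolP bc; apply/asboolP => j ji.
have [o t] := ab _ ji; have [o' t'] := bc _ ji.
by split=> z; [apply: iff_trans (o z) (o' z)|apply: iff_trans (t z) (t' z)].
Qed.

Definition trace_equiv (i : 'I_n) : equiv_rel (proc S i) :=
  EquivRel (@trace_rel i) (@trace_rel_refl i) (@trace_rel_sym i)
    (@trace_rel_trans i).

Definition trace_quot (i : 'I_n) := {eq_quot (trace_equiv i)}.

(* The classes are order-convex, so comparing some pair of representatives
   yields the total order inherited from the process. *)
Definition trace_quot_le (i : 'I_n) (C D : trace_quot i) : Prop :=
  exists x y : proc S i,
    [/\ \pi_(trace_quot i) x = C, \pi_(trace_quot i) y = D & x <= y].

Definition quotient_carrier : Type := {i : 'I_n & trace_quot i}.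

Definition event_class (x : events) : quotient_carrier :=
  Tagged trace_quot (\pi_(trace_quot (tag x)) (tagged x)).

Inductive quotient_step : relation quotient_carrier :=
| quotient_local i (C D : trace_quot i) : trace_quot_le C D ->
    quotient_step (Tagged trace_quot C) (Tagged trace_quot D)
| quotient_comm i j (x : proc S i) (y : proc S j) : comm S i j (x, y) ->
    quotient_step (event_class (Tagged (proc S) x))
                  (event_class (Tagged (proc S) y)).

Definition quotient_le : relation quotient_carrier :=
  clos_refl_trans _ quotient_step.

End DistributedSystem.

Arguments events {d n} S.
Arguments causal {d n} S.
Arguments quotient_carrier {d n} S.
Arguments quotient_le {d n} S.

Definition strict_part (T : Type) (le : relation T) : relation T :=
  fun x y => le x y /\ ~ le y x.

Local Open Scope ring_scope.

Definition RP_multi_utility (R : realType) (T : Type) (le : relation T)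
    (I : Type) (f : I -> T -> R) : Prop :=
  (forall x y, le x y <-> forall l, f l x <= f l y) /\
  (forall x y, strict_part le x y -> forall l, f l x < f l y).

(* Finiteness of T is part of the definition: N is its cardinal. *)
Definition bijective_RP_multi_utility (R : realType) (T : Type)
    (le : relation T) (I : Type) (f : I -> T -> R) : Prop :=
  RP_multi_utility le f /\
  exists2 N : nat, [set: T] #= `I_N &
    forall l, set_bij [set: T] [set m%:R | m in [set m | (1 <= m <= N)%N]] (f l).

(* Main.v *)
(* The induced family is strictly increasing along causal steps: a local step
   does not decrease u and increases w, while a communication changes process,
   hence class, so the injective integer-valued u grows by at least 1, which
   w, with values in (0, 1), cannot compensate. Conversely, v l x <= v l y for
   all l forces the class of x below that of y in the quotient; a chain of
   quotient steps from process i to another process j lifts to a causal chain,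
   because trace equivalent events see exactly the same communications. *)
Require Import Defs.
From Stdlib Require Import Relation_Definitions Relation_Operators.
From Stdlib Require Import Operators_Properties.
From mathcomp Require Import all_boot all_order all_algebra generic_quotient.
From mathcomp Require Import boolp classical_sets functions cardinality reals.
From mathcomp Require Import lra.

Set Implicit Arguments.
Unset Strict Implicit.
Unset Printing Implicit Defensive.

Import Order.TTheory GRing.Theory Num.Theory.

Local Open Scope ring_scope.
Local Open Scope quotient_scope.

Section QuotientPaths.
Variables (d : Order.disp_t) (n : nat) (S : distributed_system d n).

Lemma comm_neq (i j : 'I_n) (x : proc S i) (y : proc S j) :
  comm S i j (x, y) -> i != j.
Proof.
apply: contraPneq => ij; move: y; rewrite -ij => y.
by rewrite comm_diag.
Qed.

Lemma comm_closure_comm (i j : 'I_n) (x : proc S i) (y : proc S j) :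
  comm S i j (x, y) -> comm_closure x y.
Proof. by move=> xy; exists x, y; split. Qed.

Lemma comm_closure_lel (i j : 'I_n) (x x' : proc S i) (y : proc S j) :
  (x <= x')%O -> comm_closure x' y -> comm_closure x y.
Proof.
move=> xx' [a [b [x'a ab yb]]]; exists a, b; split=> //.
exact: le_trans xx' x'a.
Qed.

Lemma comm_closure_ler (i j : 'I_n) (x : proc S i) (y y' : proc S j) :
  (y <= y')%O -> comm_closure x y -> comm_closure x y'.
Proof.
move=> yy' [a [b [xa ab yb]]]; exists a, b; split=> //.
exact: le_trans yb yy'.
Qed.

Lemma le_clos_causal (i : 'I_n) (x y : proc S i) : (x <= y)%O ->
  clos_refl_trans _ (causal_step (comm S)) (Tagged (proc S) x)
                                           (Tagged (proc S) y).
Proof.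
rewrite le_eqVlt => /predU1P[->|xy]; first exact: rt_refl.
by apply: rt_step; exact: causal_local.
Qed.

Lemma causal_ler (x : events S) (i : 'I_n) (y y' : proc S i) : (y <= y')%O ->
  causal S x (Tagged (proc S) y) -> causal S x (Tagged (proc S) y').
Proof.
rewrite le_eqVlt => /predU1P[->//|yy'] xy.
by apply: t_trans xy _; apply: t_step; exact: causal_local.
Qed.

Lemma comm_closure_causal (i j : 'I_n) (x : proc S i) (y : proc S j) :
  comm_closure x y -> causal S (Tagged (proc S) x) (Tagged (proc S) y).
Proof.
move=> [a [b [xa ab yb]]]; apply: causal_ler yb _.
apply: clos_rt_t (le_clos_causal xa) _.
by apply: t_step; exact: causal_comm.
Qed.

Lemma comm_closure_pil (i j : 'I_n) (x x' : proc S i) (y : proc S j) :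
  j != i -> \pi_(trace_quot S i) x = \pi_(trace_quot S i) x' ->
  comm_closure x y -> comm_closure x' y.
Proof.
by move=> ji /eqmodP/asboolP/(_ j ji)[out _] /out.
Qed.

Lemma comm_closure_pir (i j : 'I_n) (x : proc S i) (y y' : proc S j) :
  i != j -> \pi_(trace_quot S j) y = \pi_(trace_quot S j) y' ->
  comm_closure x y -> comm_closure x y'.
Proof.
by move=> ij /eqmodP/asboolP/(_ i ij)[_ inn] /inn.
Qed.

(* The class invariant of quotient paths starting at the class of x: as long as
   the path stays in the process of x, only messages that x can also send are
   visible; afterwards, a message from x or its causal future has been
   received. *)
Definition reached (x y : events S) : Prop :=
  (tag y = tag x /\ forall (j : 'I_n) (z : proc S j), j != tag x ->
     comm_closure (tagged y) z -> comm_closure (tagged x) z) \/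
  (exists c : events S, [/\ tag c != tag y,
     clos_refl_trans _ (causal_step (comm S)) x c &
     comm_closure (tagged c) (tagged y)]).

(** Moving later in a process can only lose outgoing messages and gain incoming ones, so each
    alternative of [reached] persists. *)
Lemma reached_le (x : events S) (i : 'I_n) (y y' : proc S i) : (y <= y')%O ->
  reached x (Tagged (proc S) y) -> reached x (Tagged (proc S) y').
Proof.
move=> yy' [[/= ix sees]|[c [ci xc cy]]]; [left|right].
  split=> //= j z jx y'z; apply: sees => //.
  exact: comm_closure_lel yy' y'z.
by exists c; split=> //; exact: comm_closure_ler yy' cy.
Qed.

(** Both alternatives concern only messages between distinct processes, which trace equivalence
    preserves; hence the condition [tag c != tag y] in [reached]. *)
Lemma reached_pi (x : events S) (i : 'I_n) (y y' : proc S i) :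
  \pi_(trace_quot S i) y = \pi_(trace_quot S i) y' ->
  reached x (Tagged (proc S) y) -> reached x (Tagged (proc S) y').
Proof.
move=> yy' [[/= ix sees]|[c [ci xc cy]]]; [left|right].
  split=> //= j z jx y'z; apply: sees => //.
  by apply: comm_closure_pil y'z; rewrite ?ix.
by exists c; split=> //; exact: comm_closure_pir yy' cy.
Qed.

(** The second alternative always results. Its witness is [x] itself under the first alternative,
    since [x] can send whatever [y] sends, and [y] under the second. *)
Lemma reached_comm (x : events S) (i j : 'I_n) (y : proc S i) (z : proc S j) :
  comm S i j (y, z) ->
  reached x (Tagged (proc S) y) -> reached x (Tagged (proc S) z).
Proof.
move=> yz; have ij := comm_neq yz; have yz' := comm_closure_comm yz.
case=> [[/= ix sees]|[c [ci xc cy]]]; right.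
  exists x; split; [by rewrite -ix | exact: rt_refl |].
  by apply: sees => //; rewrite -ix eq_sym.
exists (Tagged (proc S) y); split=> //.
by apply: rt_trans xc _; apply: clos_t_clos_rt; case: c cy {ci} => ? ?;
  exact: comm_closure_causal.
Qed.

Lemma quotient_le_reached (x y : events S) :
  quotient_le S (event_class x) (event_class y) -> reached x y.
Proof.
(* Consecutive quotient steps share a class but not necessarily an event, so the induction along the
   path must cover every representative of its end class. *)
move=> xy; suff inv D : quotient_le S (event_class x) D ->
    forall a : proc S (tag D), \pi_(trace_quot S (tag D)) a = tagged D ->
    reached x (Tagged (proc S) a).
  by case: y xy => i y /inv; exact.
elim/clos_refl_trans_ind_left: D / => [a|C D _ IH CD].
  case: x a {xy} => i x a /= ax; apply: (reached_pi (esym ax)); left.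
  by split.
case: CD IH => [i A B [b [c [bA cB bc]]]|i j b c bc] /= IH a aE.
  apply: (reached_pi (etrans cB (esym aE))).
  by apply: reached_le bc _; exact: IH.
by apply: (reached_pi (esym aE)); apply: reached_comm bc _; exact: IH.
Qed.

(** Distinct processes exclude the first alternative of [reached]; the second gives a causal chain
    through [c]. *)
Lemma quotient_le_causal (x y : events S) : tag x != tag y ->
  quotient_le S (event_class x) (event_class y) -> causal S x y.
Proof.
move=> xy /quotient_le_reached[[yx]|[c [_ xc cy]]].
  by rewrite yx eqxx in xy.
apply: clos_rt_t xc _; case: c y cy {xy} => i c [j y].
exact: comm_closure_causal.
Qed.

End QuotientPaths.

Section InducedUtilities.
Variables (R : realType) (d : Order.disp_t) (n : nat).
Variables (S : distributed_system d n).
Variables (w : forall i : 'I_n, proc S i -> R).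
Hypothesis w_utility : forall (i : 'I_n) (x y : proc S i),
  (x <= y)%O <-> w x <= w y.
Hypothesis w_unit : forall (i : 'I_n) (x : proc S i), 0 < w x < 1.

Lemma utility_lt (i : 'I_n) (x y : proc S i) : (x < y)%O -> w x < w y.
Proof.
by rewrite !ltNge => /negP yx; apply/negP => /w_utility.
Qed.

Variable u : quotient_carrier S -> R.
Hypothesis u_nat : forall C, exists m : nat, u C = m%:R.

Lemma nat_valued_ltD1 (C D : quotient_carrier S) : u C < u D -> u C + 1 <= u D.
Proof.
have [a ->] := u_nat C; have [b ->] := u_nat D.
by rewrite ltr_nat natr1 ler_nat.
Qed.

Let v (x : events S) : R := u (event_class x) + w (tagged x).

(** Two values of [w] differ by less than 1, distinct values of [u] by at least 1. This serves for
    communications and, contraposed, to recover the order of classes from that of the sums. *)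
Lemma induced_lt_of_class_lt (x y : events S) :
  u (event_class x) < u (event_class y) -> v x < v y.
Proof.
move=> /nat_valued_ltD1; rewrite /v.
have /andP[] := w_unit (tagged x); have /andP[] := w_unit (tagged y).
by lra.
Qed.

Hypothesis u_mono : forall C D, quotient_le S C D -> u C <= u D.
Hypothesis u_inj : injective u.

Lemma induced_causal_lt (x y : events S) : causal S x y -> v x < v y.
Proof.
elim=> {x y} [x y|x y z _ xy _ yz]; last exact: lt_trans xy yz.
case=> [i a b ab|i j a b ab].
  apply: ler_ltD; last exact: utility_lt.
  apply/u_mono/rt_step/quotient_local.
  by exists a, b; split=> //; exact: ltW.
apply: induced_lt_of_class_lt; rewrite lt_neqAle; apply/andP; split.
  (* Equal values would put sender and receiver in one class, hence in one process. *)
  apply/eqP => /u_inj /(congr1 (fun C => tag C)) /= ij.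
  by have := comm_neq ab; rewrite ij eqxx.
exact/u_mono/rt_step/quotient_comm.
Qed.

End InducedUtilities.

Theorem theorem54 (R : realType) (d : Order.disp_t) (n : nat)
    (S : distributed_system d n)
    (le : relation (events S))
    (le_order : Relation_Definitions.order (events S) le)
    (le_causal : forall x y : events S, strict_part le x y <-> causal S x y)
    (w : forall i : 'I_n, proc S i -> R)
    (w_utility : forall (i : 'I_n) (x y : proc S i),
       (x <= y)%O <-> w i x <= w i y)
    (w_unit : forall (i : 'I_n) (x : proc S i), 0 < w i x < 1)
    (k : nat) (k_gt0 : (0 < k)%N)
    (u : 'I_k -> quotient_carrier S -> R)
    (u_rep : bijective_RP_multi_utility (quotient_le S) u) :
  RP_multi_utility le
    (fun (l : 'I_k) (x : events S) =>
       u l (event_class x) + w (tag x) (tagged x)).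
Proof.
have [le_refl _ le_anti] := le_order.
have [[u_le _] [N _ u_bij]] := u_rep.
have u_nat l C : exists m : nat, u l C = m%:R.
  have [u_fun _ _] := u_bij l.
  by have [m _ <-] := u_fun C I; exists m.
have u_inj l : injective (u l).
  have [_ inj _] := u_bij l.
  by move=> C D; apply: inj; rewrite inE.
have u_mono l C D : quotient_le S C D -> u l C <= u l D by move=> /u_le.
have v_lt x y : causal S x y -> forall l : 'I_k,
    u l (event_class x) + w (tag x) (tagged x) <
    u l (event_class y) + w (tag y) (tagged y).
  move=> xy l; exact: (induced_causal_lt w_utility w_unit (u_nat l)
    (u_mono l) (u_inj l)).
split; last by move=> x y /le_causal /v_lt.
have causal_le x y : causal S x y -> le x y by move=> /le_causal[].
move=> x y; split=> [xy l|v_le].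
  have [yx|nyx] := pselect (le y x); first by rewrite (le_anti _ _ xy yx).
  by apply/ltW/v_lt/le_causal; split.
have xy : quotient_le S (event_class x) (event_class y).
  apply/u_le => l; rewrite leNgt; apply/negP.
  move=> /(induced_lt_of_class_lt w_unit (u_nat l)).
  by rewrite ltNge v_le.
have [xy_tag|] := eqVneq (tag x) (tag y); last first.
  by move=> xy_tag; apply/causal_le/quotient_le_causal.
case: x y xy_tag v_le {xy} => i a [j b] /= ij; subst j => v_le.
(* Inside one process the class order cannot separate trace equivalent events, so the total order of
   the process decides. The case [b < a] contradicts [v_le] at one index, which exists by
   [k_gt0]. *)
have [ab|ba|->] := ltgtP a b; last exact: le_refl.
  by apply/causal_le/t_step/causal_local.
have /v_lt/(_ (Ordinal k_gt0)) :
    causal S (Tagged (proc S) b) (Tagged (proc S) a).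
  by apply: t_step; exact: causal_local.
by rewrite ltNge v_le.
Qed.
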